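(* Let $s\in(\frac12,1)$ and let $\Omega\subset\mathbb R^N$ be a bounded open set. Let $u,w:\mathbb R^N\to\mathbb R$ be continuous functions such that $\Delta^s_\infty u\ge0$ and $\Delta^s_\infty w\le0$ at every point of $\Omega$ in the viscosity sense; $u$ and $w$ grow less than $|x|^{2s}$ at infinity (i.e. there are $\alpha<2s$ and $C>0$ with $|u(x)|,|w(x)|\le C(1+|x|)^\alpha$); and $u\le w$ in $\mathbb R^N\setminus\Omega$. Then $u\le w$ in $\Omega$.
   Context: $S^{N-1}$ unit sphere. A function $\phi$ is $C^{1,1}$ at $x_0$ ($\phi\in C^{1,1}(x_0)$) if there are $p\in\mathbb R^N$, $M,\eta_0>0$ with $|\phi(x_0+x)-\phi(x_0)-p\cdot x|\le M|x|^2$ for $|x|<\eta_0$; $\nabla\phi(x_0):=p$. Infinity fractional Laplacian of such $\phi$: if $\nabla\phi(x)\ne0$, $v=\nabla\phi(x)/|\nabla\phi(x)|$, $\Delta^s_\infty\phi(x)=\int_0^\infty\frac{\phi(x+\eta v)+\phi(x-\eta v)-2\phi(x)}{\eta^{1+2s}}d\eta$; if $\nabla\phi(x)=0$, $\Delta^s_\infty\phi(x)=\sup_{y\in S^{N-1}}\int_0^\infty\frac{\phi(x+\eta y)-\phi(x)}{\eta^{1+2s}}d\eta+\inf_{z\in S^{N-1}}\int_0^\infty\frac{\phi(x-\eta z)-\phi(x)}{\eta^{1+2s}}d\eta$. Viscosity sense: an upper [lower] semicontinuous $u$ satisfies $\Delta^s_\infty u(x_0)\ge0$ [$\le0$] if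 whenever $r>0$, $\phi\in C^{1,1}(x_0)\cap C(\overline{B_r(x_0)})$, $\phi(x_0)=u(x_0)$ and $\phi>u$ [$\phi<u$] on $B_r(x_0)\setminus\{x_0\}$, the function $\tilde u$ equal to $\phi$ on $B_r(x_0)$ and to $u$ elsewhere satisfies $\Delta^s_\infty\tilde u(x_0)\ge0$ [$\le0$]. *)

(* Defs.v *)
From HB Require Import structures.
From mathcomp Require Import all_boot all_order all_algebra.
From mathcomp Require Import all_classical all_reals all_analysis.
Set Implicit Arguments. Unset Strict Implicit. Unset Printing Implicit Defensive.
Import Order.TTheory GRing.Theory Num.Theory.
Import numFieldNormedType.Exports.
Local Open Scope classical_set_scope.
Local Open Scope ring_scope.

Definition dotv {R : realType} {N : nat} (x y : 'rV[R]_N) : R :=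
  \sum_(i < N) x ord0 i * y ord0 i.

Definition enorm {R : realType} {N : nat} (x : 'rV[R]_N) : R :=
  Num.sqrt (dotv x x).

Definition unit_sphere (R : realType) (N : nat) : set 'rV[R]_N :=
  [set y | enorm y = 1].

Definition eball {R : realType} {N : nat} (x0 : 'rV[R]_N) (r : R) : set 'rV[R]_N :=
  [set x | enorm (x - x0) < r].
Definition eclosed_ball {R : realType} {N : nat} (x0 : 'rV[R]_N) (r : R) : set 'rV[R]_N :=
  [set x | enorm (x - x0) <= r].

Definition C11_at {R : realType} {N : nat} (phi : 'rV[R]_N -> R) (x0 p : 'rV[R]_N) : Prop :=
  exists M eta0 : R, 0 < M /\ 0 < eta0 /\
    forall x : 'rV[R]_N, enorm x < eta0 ->
      `| phi (x0 + x) - phi x0 - dotv p x | <= M * enorm x ^+ 2.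

Definition one_sided_int {R : realType} {N : nat} (s : R) (phi : 'rV[R]_N -> R)
  (x y : 'rV[R]_N) : \bar R :=
  (\int[lebesgue_measure]_(eta in `](0%R:R), +oo[%classic)
     ((phi (x + eta *: y) - phi x) / eta `^ (1 + 2 * s))%:E)%E.

(** Infinity fractional Laplacian of phi at x, where p is the gradient
    of phi at x (phi being C^{1,1} at x). *)
Definition frac_inf_lap {R : realType} {N : nat} (s : R) (phi : 'rV[R]_N -> R)
  (x p : 'rV[R]_N) : \bar R :=
  if p != 0 then
    let v := (enorm p)^-1 *: p in
    (\int[lebesgue_measure]_(eta in `](0%R:R), +oo[%classic)
       ((phi (x + eta *: v) + phi (x - eta *: v) - 2 * phi x)
          / eta `^ (1 + 2 * s))%:E)%E
  else
    (ereal_sup [set one_sided_int s phi x y | y in @unit_sphere R N]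
     + ereal_inf [set one_sided_int s phi x (- z) | z in @unit_sphere R N])%E.

Definition glue {R : realType} {N : nat} (u phi : 'rV[R]_N -> R) (x0 : 'rV[R]_N) (r : R)
  : 'rV[R]_N -> R :=
  fun x => if `[< eball x0 r x >] then phi x else u x.

Definition visc_sub {R : realType} {N : nat} (s : R) (u : 'rV[R]_N -> R) (x0 : 'rV[R]_N) : Prop :=
  forall (r : R) (phi : 'rV[R]_N -> R) (p : 'rV[R]_N),
    0 < r -> C11_at phi x0 p ->
    {within eclosed_ball x0 r, continuous phi} ->
    phi x0 = u x0 ->
    (forall x, eball x0 r x -> x != x0 -> phi x > u x) ->
    (0 <= frac_inf_lap s (glue u phi x0 r) x0 p)%E.

Definition visc_super {R : realType} {N : nat} (s : R) (u : 'rV[R]_N -> R) (x0 : 'rV[R]_N) : Prop :=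
  forall (r : R) (phi : 'rV[R]_N -> R) (p : 'rV[R]_N),
    0 < r -> C11_at phi x0 p ->
    {within eclosed_ball x0 r, continuous phi} ->
    phi x0 = u x0 ->
    (forall x, eball x0 r x -> x != x0 -> phi x < u x) ->
    (frac_inf_lap s (glue u phi x0 r) x0 p <= 0)%E.

Definition subcritical_growth {R : realType} {N : nat} (s : R) (u : 'rV[R]_N -> R) : Prop :=
  exists alpha C : R, alpha < 2 * s /\ 0 < C /\
    forall x, `| u x | <= C * (1 + enorm x) `^ alpha.

(* Main.v *)
(** Doubling of variables.  Suppose [u - w] has a positive value [m] and let
    [(x0, y0)] maximise [u x - w y - e |x - y|^2] over the square of a large box.
    For [e] large both points lie in [Omega], and the maximality provides
    paraboloids touching [u] from above at [x0] and [w] from below at [y0], with the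
    same gradient [p = 2 e (x0 - y0)].  Along every ray of direction [v], the
    increment of [u] from [x0] minus that of [w] from [y0] is at most
    - [2 (e + 1) eta^2] for [eta < r], where the paraboloids replace [u] and [w];
    - [0] as long as the ray stays in the box, by maximality;
    - [- m / 2] on a fixed interval [[a, a + 1]] on which the ray is outside [Omega];
    - [O(eta^alpha)] beyond the box, with [alpha < 2 s].
    After integration against [eta^(-1-2s)] the third contribution is a fixed
    negative number, the last one is small because the box is large, and the first
    one is small because [r] is chosen last.  Hence the one-sided integrals of [u]
    are uniformly smaller than those of [w], which contradicts the viscosity
    inequalities whether [p] vanishes or not.  A box is needed because [u] and [w]
    may oscillate at infinity, so that no maximum over the whole space exists. *)

Require Import Defs.
From HB Require Import structures.
From mathcomp Require Import all_boot all_order all_algebra.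
From mathcomp Require Import all_classical all_reals all_analysis.
From mathcomp Require Import measurable_realfun ring lra.
Set Implicit Arguments. Unset Strict Implicit. Unset Printing Implicit Defensive.
Import Order.TTheory GRing.Theory Num.Theory.
Import numFieldNormedType.Exports.
Local Open Scope classical_set_scope.
Local Open Scope ring_scope.

(** * Integrals of powers *)

Section powR_integrals.
Context {R : realType}.
Notation mu := (@lebesgue_measure R).

Lemma powR_continuous (e x : R) : 0 < x -> {for x, continuous (@powR R ^~ e)}.
Proof.
move=> x0; apply: differentiable_continuous; apply/derivable1_diffP.
by apply: derivable_powR; rewrite in_itv/= x0.
Qed.

Lemma is_derive_powR_div (g c x : R) : 0 < x ->
  is_derive x 1 (fun y : R => y `^ g / c) (g * x `^ (g - 1) / c).
Proof.
move=> x0; have := is_derive1_powR g x0 => H.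
have -> : (fun y : R => y `^ g / c) = c^-1 *: (@powR R ^~ g).
  by apply/funext => y; rewrite mulrC.
have -> : g * x `^ (g - 1) / c = c^-1 *: (g * x `^ (g - 1)) by rewrite mulrC.
exact: is_deriveZ.
Qed.

Lemma continuous_powR_div (g c x : R) : 0 < x ->
  {for x, continuous (fun y : R => y `^ g / c)}.
Proof.
move=> x0; apply: differentiable_continuous; apply/derivable1_diffP.
by have [] := is_derive_powR_div g c x0.
Qed.

Lemma powR_pinfty_cvg0 (g : R) : 0 < g -> (x `^ (- g)) @[x --> +oo] --> (0 : R).
Proof.
move=> g0; apply/cvgrPdist_le => /= e e0.
near=> x.
have x0 : 0 < x by near: x; exact: nbhs_pinfty_gt.
rewrite sub0r normrN ger0_norm ?powR_ge0//.
have xe : e `^ (- g^-1) <= x by near: x; exact: nbhs_pinfty_ge.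
rewrite powRN -[e]invrK lef_pV2 ?posrE ?powR_gt0 ?invr_gt0//.
have -> : e^-1 = (e `^ (- g^-1)) `^ g.
  by rewrite -powRrM mulNr mulVf ?gt_eqF// powR_inv1 ?ltW.
by apply: ge0_ler_powR; rewrite ?nnegrE ?powR_ge0 ?(ltW g0)//; exact: ltW.
Unshelve. all: by end_near. Qed.

Lemma integral_powR_tail (g b : R) : 0 < g -> 0 < b ->
  (\int[mu]_(x in `[b, +oo[) (x `^ (- g - 1))%:E = (b `^ (- g) / g)%:E)%E.
Proof.
move=> g0 b0; have gN0 : - g != 0 by rewrite oppr_eq0 gt_eqF.
have dF (x : R) : 0 < x ->
    is_derive x 1 (fun y : R => y `^ (- g) / (- g)) (x `^ (- g - 1)).
  move=> x0; have := is_derive_powR_div (- g) (- g) x0.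
  by rewrite mulrAC divff// mul1r.
rewrite (@ge0_continuous_FTC2y _ _ (fun y : R => y `^ (- g) / (- g)) b 0).
- by rewrite -EFinB sub0r invrN mulrN opprK.
- by move=> x _; exact: powR_ge0.
- apply: continuous_in_subspaceT => x; rewrite inE/= in_itv/= andbT => bx.
  by apply: powR_continuous; exact: lt_le_trans bx.
- rewrite -[X in _ --> X](mul0r (- g)^-1).
  by apply: cvgMr_tmp; exact: powR_pinfty_cvg0.
- by move=> x bx; have [] := dF x (lt_trans b0 bx).
- by apply: cvg_at_right_filter; exact: continuous_powR_div.
- move=> x; rewrite in_itv/= andbT => bx; rewrite derive1E.
  by have [_ ->] := dF x (lt_trans b0 bx).
Qed.

(** For [g < 1] the integrand blows up at 0, so the fundamental theorem of calculus is applied on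
    compact intervals exhausting []0, r]], and monotone convergence concludes. *)
Lemma integral_powR_near0 (g r : R) : 0 < g -> 0 < r ->
  (\int[mu]_(x in `]0%R, r]) (x `^ (g - 1))%:E <= (r `^ g / g)%:E)%E.
Proof.
move=> g0 r0.
have dF (x : R) : 0 < x ->
    is_derive x 1 (fun y : R => y `^ g / g) (x `^ (g - 1)).
  move=> x0; have := is_derive_powR_div g g x0.
  by rewrite mulrAC divff ?gt_eqF// mul1r.
(* The shift [n.+2] keeps the left end strictly below [r], already at [n = 0]. *)
pose F n := `[r / n.+2%:R, r]%classic.
have rn n : 0 < r / n.+2%:R by rewrite divr_gt0.
have -> : `]0%R, r]%classic = \bigcup_n F n.
  apply/seteqP; split => x; rewrite /F/= ?in_itv/=.
    move=> /andP[x0 xr]; have [n nx] : exists n, r / x < n%:R.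
      by exists (Num.truncn (r / x)).+1; rewrite truncnS_gt.
    exists n => //=; rewrite in_itv/= xr andbT.
    rewrite ler_pdivrMr// mulrC -ler_pdivrMr//.
    by rewrite (le_trans (ltW nx))// ler_nat -addn2 leq_addr.
  by move=> [n _ /=]; rewrite in_itv/= => /andP[nx ->]; rewrite (lt_le_trans (rn n)).
have mF i : measurable_fun (F i) (EFin \o (@powR R ^~ (g - 1))).
  by apply/measurable_EFinP/measurable_funTS; exact: measurable_powR.
have cvgF : (\int[mu]_(x in F i) (x `^ (g - 1))%:E)%E @[i --> \oo] -->
    (\int[mu]_(x in \bigcup_i F i) (x `^ (g - 1))%:E)%E.
  apply: ge0_nondecreasing_set_cvg_integral => //.
  - apply/nondecreasing_seqP => n; rewrite subsetEset => x; rewrite /F/= !in_itv/=.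
    move=> /andP[nx ->]; rewrite andbT (le_trans _ nx)// ler_pM2l// lef_pV2 ?posrE//.
    by rewrite ler_nat.
  - by move=> i; rewrite /F; exact: measurable_itv.
  - by move=> i x _; rewrite lee_fin powR_ge0.
rewrite -(cvg_lim _ cvgF)//; apply: lime_le; first by apply/cvg_ex; eexists; exact: cvgF.
apply: nearW => n.
rewrite (@continuous_FTC2 _ _ (fun y : R => y `^ g / g)).
- by rewrite -EFinB lee_fin gerBl divr_ge0 ?powR_ge0// ltW.
- by rewrite ltr_pdivrMr// ltr_pMr// ltr1n.
- apply: continuous_in_subspaceT => x; rewrite inE/= in_itv/= => /andP[bx _].
  by apply: powR_continuous; exact: lt_le_trans bx.
- split.
  + by move=> x; rewrite in_itv/= => /andP[bx _]; have [] := dF x (lt_trans (rn n) bx).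
  + by apply: cvg_at_right_filter; exact: continuous_powR_div (rn n).
  + by apply: cvg_at_left_filter; exact: continuous_powR_div r0.
- move=> x; rewrite in_itv/= => /andP[bx _]; rewrite derive1E.
  by have [_ ->] := dF x (lt_trans (rn n) bx).
Qed.


Lemma exists_powR_small (g c : R) : 0 < g -> 0 < c ->
  exists2 r : R, 0 < r < 1 & r `^ g <= c.
Proof.
move=> g0 c0; have /cvgrPdist_le /(_ _ c0) H := @powR_cvg0 R g g0.
near (0 : R)^'+ => r; exists r.
  by apply/andP; split; near: r; [exact: nbhs_right_gt|exact: nbhs_right_lt].
have : `|0 - r `^ g| <= c by near: r; exact: H.
by rewrite sub0r normrN ger0_norm// powR_ge0.
Unshelve. all: by end_near. Qed.

Lemma exists_powRN_small (g c b0 : R) : 0 < g -> 0 < c ->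
  exists2 b : R, b0 <= b & b `^ (- g) <= c.
Proof.
move=> g0 c0; have /cvgrPdist_le /(_ _ c0) H := powR_pinfty_cvg0 g0.
near (pinfty_nbhs R) => b.
exists b; first by near: b; apply: nbhs_pinfty_ge; exact: num_real.
have : `|0 - b `^ (- g)| <= c by near: b; exact: H.
by rewrite sub0r normrN ger0_norm// powR_ge0.
Unshelve. all: by end_near. Qed.

End powR_integrals.

(** * Integration against [eta^(-1-2s)] *)

Section kernel_integral.
Context {R : realType}.
Notation mu := (@lebesgue_measure R).

(** The quadratic order at 0 is what a paraboloid leaves once its linear part is removed; the power
    [alpha] is the growth allowed at infinity. *)
Definition growth_weight (alpha eta : R) : R :=
  if eta <= 1 then eta ^+ 2 else eta `^ alpha.

(** A real number, so that linear arithmetic applies; it is 0 by default when the integral is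
    infinite, hence it is meaningful on [admissible] functions, where [kintE] identifies it with the
    extended integral. *)
Definition kint (s : R) (tau : R -> R) : R :=
  \int[mu]_(eta in `]0%R, +oo[) (tau eta / eta `^ (1 + 2 * s)).

Definition admissible (alpha : R) (tau : R -> R) :=
  measurable_fun [set: R] tau /\
  exists C : R, forall eta, 0 < eta -> `|tau eta| <= C * growth_weight alpha eta.

Lemma growth_weight_ge0 alpha eta : 0 <= growth_weight alpha eta.
Proof. by rewrite /growth_weight; case: ifP => _; rewrite ?sqr_ge0 ?powR_ge0. Qed.

Lemma measurable_growth_weight alpha : measurable_fun [set: R] (growth_weight alpha).
Proof.
apply: measurable_fun_ifT.
- by apply: measurable_fun_ler.
- exact: measurable_funX.
- exact: measurable_powR.
Qed.

Lemma sqr_div_powR (e x : R) : 0 < x -> x ^+ 2 / x `^ (1 + e) = x `^ (1 - e).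
Proof.
move=> x0; rewrite -powR_mulrn ?ltW// -powRB; last by rewrite (gt_eqF x0) implybT.
by congr powR; ring.
Qed.

Lemma powR_div_powR (a e x : R) : 0 < x -> x `^ a / x `^ (1 + e) = x `^ (- (e - a) - 1).
Proof.
move=> x0; rewrite -powRB; last by rewrite (gt_eqF x0) implybT.
by congr powR; ring.
Qed.

Lemma measurable_kernel s (tau : R -> R) : measurable_fun [set: R] tau ->
  measurable_fun [set: R] (fun eta => tau eta / eta `^ (1 + 2 * s)).
Proof.
move=> mt; have -> : (fun eta => tau eta / eta `^ (1 + 2 * s)) =
    (fun eta => tau eta * eta `^ (- (1 + 2 * s))).
  by apply/funext => x; rewrite powRN.
by apply: measurable_funM => //; exact: measurable_powR.
Qed.

Lemma integrable_powR_near0 (g r : R) : 0 < g -> 0 < r ->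
  mu.-integrable `]0%R, r] (EFin \o (fun x : R => x `^ (g - 1))).
Proof.
move=> g0 r0; apply/integrableP; split.
  by apply/measurable_EFinP/measurable_funTS; exact: measurable_powR.
under eq_integral do rewrite /= ger0_norm ?powR_ge0//.
exact: le_lt_trans (integral_powR_near0 g0 r0) (ltry _).
Qed.

Lemma integrable_powR_tail (g b : R) : 0 < g -> 0 < b ->
  mu.-integrable `[b, +oo[ (EFin \o (fun x : R => x `^ (- g - 1))).
Proof.
move=> g0 r0; apply/integrableP; split.
  by apply/measurable_EFinP/measurable_funTS; exact: measurable_powR.
under eq_integral do rewrite /= ger0_norm ?powR_ge0//.
by rewrite integral_powR_tail// ltry.
Qed.

(** After division by the kernel the exponents are [1 - 2 * s > -1] near 0 and
    [alpha - 1 - 2 * s < -1] at infinity. The two power functions overlap at [eta = 1], so their sum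
    dominates the weight without being equal to it. *)
Lemma integrable_growth_weight (s alpha : R) : s < 1 -> alpha < 2 * s ->
  mu.-integrable `]0%R, +oo[
    (EFin \o (fun eta : R => growth_weight alpha eta / eta `^ (1 + 2 * s))).
Proof.
move=> s1 as2.
have g1 : 0 < 2 - 2 * s by lra.
have g2 : 0 < 2 * s - alpha by lra.
pose f1 := (EFin \o (fun x : R => x `^ ((2 - 2 * s) - 1))) \_ `]0%R, 1%R].
pose f2 := (EFin \o (fun x : R => x `^ (- (2 * s - alpha) - 1))) \_ `[1%R, +oo[.
have i1 : mu.-integrable `]0%R, +oo[ f1.
  apply/integrable_restrict => //.
  apply: integrableS (integrable_powR_near0 g1 ltr01) => //.
  by apply: measurableI; exact: measurable_itv.
have i2 : mu.-integrable `]0%R, +oo[ f2.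
  apply/integrable_restrict => //.
  apply: integrableS (integrable_powR_tail g2 ltr01) => //.
  by apply: measurableI; exact: measurable_itv.
apply: (le_integrable _ _ _ (integrableD _ i1 i2)) => //.
  apply/measurable_EFinP/measurable_funTS.
  by apply: measurable_kernel; exact: measurable_growth_weight.
move=> x /=; rewrite in_itv/= andbT => x0.
rewrite /f1 /f2 !patchE /growth_weight.
have [x1|x1] := leP x 1.
  rewrite mem_set; last by rewrite /= in_itv/= x0 x1.
  rewrite sqr_div_powR// (_ : 2 - 2 * s - 1 = 1 - 2 * s); last by ring.
  case: ifP => _ /=; last by rewrite addr0.
  by rewrite !ger0_norm ?addr_ge0 ?powR_ge0// lee_fin lerDl powR_ge0.
rewrite memNset; last by rewrite /= in_itv/= x0/=; lra.
rewrite mem_set; last by rewrite /= in_itv/= (ltW x1).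
by rewrite powR_div_powR//= add0r.
Qed.

Lemma integrable_kernel (s alpha : R) (tau : R -> R) : s < 1 -> alpha < 2 * s ->
  admissible alpha tau -> mu.-integrable `]0%R, +oo[
    (EFin \o (fun eta : R => tau eta / eta `^ (1 + 2 * s))).
Proof.
move=> s1 as2 [mt [C HC]].
apply: (le_integrable _ _ _
  (integrableZl _ C (integrable_growth_weight s1 as2))) => //.
  by apply/measurable_EFinP/measurable_funTS; exact: measurable_kernel.
move=> x /=; rewrite in_itv/= andbT => x0.
rewrite lee_fin mulrA normrM [leRHS]normrM ler_wpM2r//.
exact: le_trans (HC x x0) (ler_norm _).
Qed.

Lemma kintE (s alpha : R) (tau : R -> R) : s < 1 -> alpha < 2 * s ->
  admissible alpha tau ->
  (\int[mu]_(eta in `]0%R, +oo[) (tau eta / eta `^ (1 + 2 * s))%:E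
    = (kint s tau)%:E)%E.
Proof.
move=> s1 as2 /(integrable_kernel s1 as2) it.
by rewrite /kint /Rintegral fineK//; exact: integrable_fin_num.
Qed.

Lemma kintD (s alpha : R) (t1 t2 : R -> R) : s < 1 -> alpha < 2 * s ->
  admissible alpha t1 -> admissible alpha t2 ->
  kint s (fun eta => t1 eta + t2 eta) = kint s t1 + kint s t2.
Proof.
move=> s1 as2 /(integrable_kernel s1 as2) i1 /(integrable_kernel s1 as2) i2.
rewrite /kint -RintegralD//.
by apply: eq_Rintegral => x _; rewrite mulrDl.
Qed.

Lemma le_kint (s alpha : R) (t1 t2 : R -> R) : s < 1 -> alpha < 2 * s ->
  admissible alpha t1 -> admissible alpha t2 ->
  (forall eta, 0 < eta -> t1 eta <= t2 eta) -> kint s t1 <= kint s t2.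
Proof.
move=> s1 as2 /(integrable_kernel s1 as2) i1 /(integrable_kernel s1 as2) i2 t12.
apply: le_Rintegral => // x /=; rewrite in_itv/= andbT => x0.
by rewrite ler_wpM2r ?invr_ge0 ?powR_ge0// t12.
Qed.

Lemma admissibleD (alpha : R) (t1 t2 : R -> R) :
  admissible alpha t1 -> admissible alpha t2 ->
  admissible alpha (fun eta => t1 eta + t2 eta).
Proof.
move=> [m1 [C1 H1]] [m2 [C2 H2]]; split; first exact: measurable_funD.
exists (C1 + C2) => x x0; rewrite mulrDl (le_trans (ler_normD _ _))//.
by rewrite lerD ?H1 ?H2.
Qed.

Lemma admissibleZ (alpha c : R) (t : R -> R) :
  admissible alpha t -> admissible alpha (fun eta => c * t eta).
Proof.
move=> [m1 [C1 H1]]; split; first exact: measurable_funM.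
by exists (`|c| * C1) => x x0; rewrite normrM -mulrA ler_wpM2l// H1.
Qed.

Lemma admissible_growth_weight (alpha : R) : admissible alpha (growth_weight alpha).
Proof.
split; first exact: measurable_growth_weight.
by exists 1 => x x0; rewrite mul1r ger0_norm// growth_weight_ge0.
Qed.

Lemma kintZ (s alpha c : R) (t : R -> R) : s < 1 -> alpha < 2 * s ->
  admissible alpha t -> kint s (fun eta => c * t eta) = c * kint s t.
Proof.
move=> s1 as2 /(integrable_kernel s1 as2) i1; rewrite /kint -RintegralZl//.
by apply: eq_Rintegral => x _; rewrite mulrA.
Qed.

Lemma normr_kint_le (s alpha C : R) (t : R -> R) : s < 1 -> alpha < 2 * s ->
  measurable_fun [set: R] t ->
  (forall eta, 0 < eta -> `|t eta| <= C * growth_weight alpha eta) ->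
  `|kint s t| <= C * kint s (growth_weight alpha).
Proof.
move=> s1 as2 mt Ht.
have at_ : admissible alpha t by split => //; exists C.
have aw := admissible_growth_weight alpha.
rewrite -(kintZ _ s1 as2 aw) ler_norml; apply/andP; split.
  rewrite -mulN1r -(kintZ _ s1 as2); last exact: admissibleZ.
  apply: (le_kint s1 as2) => //; first by do 2 apply: admissibleZ.
  by move=> x x0; rewrite mulN1r lerNl (le_trans _ (Ht _ x0))// -normrN ler_norm.
apply: (le_kint s1 as2) => //; first exact: admissibleZ.
by move=> x x0; rewrite (le_trans _ (Ht _ x0))// ler_norm.
Qed.

(** * Kernel integrals of the three profiles: near the origin, gap, tail *)

Lemma admissible_near0 (alpha k r : R) : r <= 1 ->
  admissible alpha (fun eta => if eta < r then k * eta ^+ 2 else 0).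
Proof.
move=> r1; split.
  apply: measurable_fun_ifT => //.
  - by apply: measurable_fun_ltr.
  - by apply: measurable_funM => //; exact: measurable_funX.
exists `|k| => x x0; case: ifPn => xr; last by rewrite normr0 mulr_ge0// growth_weight_ge0.
rewrite /growth_weight ifT; last by rewrite ltW// (lt_le_trans xr).
by rewrite normrM ler_wpM2l// ger0_norm// sqr_ge0.
Qed.

Lemma kint_near0 (s k r : R) : s < 1 -> 0 <= k -> 0 < r ->
  kint s (fun eta => if eta < r then k * eta ^+ 2 else 0)
  <= k * (r `^ (2 - 2 * s) / (2 - 2 * s)).
Proof.
move=> s1 k0 r0; have g1 : 0 < 2 - 2 * s by lra.
have i1 := integrable_powR_near0 g1 r0.
have -> : kint s (fun eta => if eta < r then k * eta ^+ 2 else 0) =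
    k * \int[mu]_(x in `]0%R, r]) (x `^ ((2 - 2 * s) - 1)).
  (* The profile vanishes at [eta = r] but the power integral includes that point, which is
     negligible. *)
  rewrite -RintegralZl// -Rintegral_itv_bndo_bndc; last first.
    apply: (integrableS _ _ _ (integrableZl _ k i1)) => // x /=.
    by rewrite !in_itv/= => /andP[-> /ltW].
  have -> : `]0%R, r[%classic = `]0%R, +oo[%classic `&` `]0%R, r[%classic.
    by apply/esym/setIidr => x/=; rewrite !in_itv/= => /andP[->].
  rewrite Rintegral_mkcondr; apply: eq_Rintegral => x.
  rewrite inE/= in_itv/= andbT => x0; rewrite patchE.
  case: ifPn => xr.
    rewrite mem_set; last by rewrite /= in_itv/= x0.
    rewrite -mulrA sqr_div_powR//; congr (_ * _ `^ _); ring.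
  by rewrite memNset ?mul0r//= in_itv/= x0/=; exact/negP.
rewrite ler_wpM2l// -lee_fin /Rintegral fineK; last exact: integrable_fin_num.
exact: integral_powR_near0.
Qed.

Lemma admissible_tail (alpha A b : R) : 1 <= b ->
  admissible alpha (fun eta => if b <= eta then A * eta `^ alpha else 0).
Proof.
move=> b1; split.
  apply: measurable_fun_ifT => //.
  - by apply: measurable_fun_ler.
  - by apply: measurable_funM => //; exact: measurable_powR.
exists `|A| => x x0; case: ifPn => xb; last by rewrite normr0 mulr_ge0// growth_weight_ge0.
rewrite normrM ler_wpM2l// ger0_norm ?powR_ge0// /growth_weight.
case: ifPn => // x1; have -> : x = 1 by lra.
by rewrite powR1 expr1n.
Qed.

Lemma kint_tail (s alpha A b : R) : alpha < 2 * s -> 0 < b ->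
  kint s (fun eta => if b <= eta then A * eta `^ alpha else 0)
  = A * (b `^ (- (2 * s - alpha)) / (2 * s - alpha)).
Proof.
move=> as2 b0; have g1 : 0 < 2 * s - alpha by lra.
have i1 := integrable_powR_tail g1 b0.
rewrite -[_ / _]/(fine (_ / _)%:E) -integral_powR_tail// -/(Rintegral _ _ _).
rewrite -RintegralZl//.
have -> : `[b, +oo[%classic = `]0%R, +oo[%classic `&` `[b, +oo[%classic.
  apply/esym/setIidr => x/=; rewrite !in_itv/= !andbT; exact: lt_le_trans.
rewrite Rintegral_mkcondr; apply: eq_Rintegral => x.
rewrite inE/= in_itv/= andbT => x0; rewrite patchE.
case: ifPn => xr.
  rewrite mem_set; last by rewrite /= in_itv/= andbT.
  by rewrite -mulrA powR_div_powR.
by rewrite memNset ?mul0r//= in_itv/= andbT; exact/negP.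
Qed.

(** Since [a >= 1] and [alpha >= 0], the weight is at least 1 on the support of the profile. *)
Lemma admissible_gap (alpha c a : R) : 0 <= alpha -> 1 <= a ->
  admissible alpha (fun eta => if a <= eta <= a + 1 then - c else 0).
Proof.
move=> al0 a1; split.
  apply: measurable_fun_ifT => //.
  apply: measurable_and; first exact: (@measurable_fun_ler _ _ _ _ (cst a) id).
  exact: (@measurable_fun_ler _ _ _ _ id (cst (a + 1))).
exists `|c| => x x0; case: ifPn => xb; last by rewrite normr0 mulr_ge0// growth_weight_ge0.
rewrite normrN ler_peMr// /growth_weight.
move: xb => /andP[ax _].
case: ifPn => x1; first by rewrite (_ : x = 1) ?expr1n//; lra.
by rewrite -(powRr0 x) ler_powR//; lra.
Qed.

(** The interval has length 1, and on it the decreasing kernel is at least its value at [a + 1]. *)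
Lemma kint_gap (s alpha c a : R) : 1 / 2 < s -> s < 1 -> 0 <= alpha -> alpha < 2 * s ->
  0 <= c -> 1 <= a ->
  kint s (fun eta => if a <= eta <= a + 1 then - c else 0)
  <= - (c / (a + 1) `^ (1 + 2 * s)).
Proof.
move=> s2 s1 al0 as2 c0 a1.
have E : `]0%R, +oo[%classic `&` `[a, a + 1]%classic = `[a, a + 1]%classic.
  by apply/setIidr => x/=; rewrite !in_itv/= andbT => /andP[ax _]; lra.
set d := - (c / (a + 1) `^ (1 + 2 * s)).
have <- : \int[mu]_(x in `]0%R, +oo[) ((cst d \_ `[a, a + 1]) x) = d.
  rewrite -Rintegral_mkcondr E Rintegral_cst//= lebesgue_measure_itv/= lte_fin.
  by rewrite ltrDl ltr01 -EFinB/= addrAC subrr add0r mulr1.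
apply: le_Rintegral => //.
- apply: (integrable_kernel s1 as2); exact: admissible_gap.
- rewrite -restrict_EFin; apply/integrable_restrict => //; rewrite E.
  apply: (@continuous_compact_integrable _ (cst d)); first exact: segment_compact.
  by apply: continuous_subspaceT => x; exact: cvg_cst.
- move=> x/=; rewrite in_itv/= andbT => x0; rewrite patchE.
  case: ifPn => xa; last by rewrite memNset ?mul0r//= in_itv/=; exact/negP.
  rewrite mem_set/=; last by rewrite in_itv.
  rewrite /d mulNr lerN2 ler_wpM2l// lef_pV2 ?posrE ?powR_gt0//; last by lra.
  apply: ge0_ler_powR; rewrite ?nnegrE; lra.
Qed.

End kernel_integral.

(** * Euclidean vectors and compactness *)

Section euclidean.
Context {R : realType} {N : nat}.
Implicit Types (x y z p v : 'rV[R]_N) (a b c : R).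

Lemma dotvC x y : dotv x y = dotv y x.
Proof. by apply: eq_bigr => i _; rewrite mulrC. Qed.

Lemma dotvDl x y z : dotv (x + y) z = dotv x z + dotv y z.
Proof. by rewrite /dotv -big_split/=; apply: eq_bigr => i _; rewrite mxE mulrDl. Qed.

Lemma dotvZl a x y : dotv (a *: x) y = a * dotv x y.
Proof. by rewrite /dotv big_distrr/=; apply: eq_bigr => i _; rewrite mxE mulrA. Qed.

Lemma dotvDr x y z : dotv x (y + z) = dotv x y + dotv x z.
Proof. by rewrite dotvC dotvDl !(dotvC x). Qed.

Lemma dotvZr a x y : dotv x (a *: y) = a * dotv x y.
Proof. by rewrite dotvC dotvZl (dotvC x). Qed.

Lemma dotvNl x y : dotv (- x) y = - dotv x y.
Proof. by rewrite -scaleN1r dotvZl mulN1r. Qed.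

Lemma dotvNr x y : dotv x (- y) = - dotv x y.
Proof. by rewrite dotvC dotvNl dotvC. Qed.

Lemma dotv0l x : dotv 0 x = 0.
Proof. by rewrite -(scale0r x) dotvZl mul0r. Qed.

Lemma dotvv_ge0 x : 0 <= dotv x x.
Proof. by apply: sumr_ge0 => i _; rewrite -expr2 sqr_ge0. Qed.

Lemma sqr_enorm x : enorm x ^+ 2 = dotv x x.
Proof. by rewrite sqr_sqrtr// dotvv_ge0. Qed.

Lemma enorm_ge0 x : 0 <= enorm x.
Proof. exact: sqrtr_ge0. Qed.

Lemma enormZ a x : enorm (a *: x) = `|a| * enorm x.
Proof.
by rewrite /enorm dotvZl dotvZr mulrA -expr2 sqrtrM ?sqr_ge0// sqrtr_sqr.
Qed.

Lemma enormN x : enorm (- x) = enorm x.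
Proof. by rewrite -scaleN1r enormZ normrN normr1 mul1r. Qed.

Lemma normr_coord_le x i : `|x ord0 i| <= enorm x.
Proof.
rewrite -sqrtr_sqr ler_sqrt ?dotvv_ge0// /dotv (bigD1 i)//= -expr2 lerDl.
by apply: sumr_ge0 => j _; rewrite -expr2 sqr_ge0.
Qed.

Lemma enorm_eq0 x : enorm x = 0 -> x = 0.
Proof.
move=> x0; apply/rowP => i; rewrite mxE; apply/eqP.
by rewrite -normr_le0 -x0 normr_coord_le.
Qed.

(** Cauchy-Schwarz, by expanding the squared norm of [enorm y *: x - enorm x *: y], which is
    [2 * (a * b) * (a * b - d)] in the notation below; vanishing norms are set apart to allow the
    division by [a * b]. *)
Lemma dotv_le_enorm x y : dotv x y <= enorm x * enorm y.
Proof.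
have := enorm_ge0 x; rewrite le_eqVlt => /predU1P[/esym/enorm_eq0 ->|x0].
  by rewrite dotv0l mulr_ge0 ?enorm_ge0.
have := enorm_ge0 y; rewrite le_eqVlt => /predU1P[/esym/enorm_eq0 ->|y0].
  by rewrite dotvC dotv0l mulr_ge0 ?enorm_ge0.
have := dotvv_ge0 (enorm y *: x - enorm x *: y).
rewrite !(dotvDl, dotvDr, dotvNl, dotvNr, dotvZl, dotvZr) (dotvC y x).
rewrite -!sqr_enorm.
set a := enorm x; set b := enorm y; set d := dotv x y => H.
have : 0 <= (a * b) * (a * b - d) by nra.
by rewrite pmulr_rge0 ?mulr_gt0// subr_ge0.
Qed.

Lemma enormD x y : enorm (x + y) <= enorm x + enorm y.
Proof.
rewrite -(@ler_pXn2r _ 2%N)// ?nnegrE ?addr_ge0 ?enorm_ge0//.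
rewrite sqr_enorm !(dotvDl, dotvDr) (dotvC y x) sqrrD !sqr_enorm.
have := dotv_le_enorm x y; rewrite mulr2n; lra.
Qed.

Lemma enorm_normalize p : p != 0 -> enorm ((enorm p)^-1 *: p) = 1.
Proof.
move=> p0; rewrite enormZ ger0_norm ?invr_ge0 ?enorm_ge0// mulVf//.
by apply: contra p0 => /eqP/enorm_eq0 ->.
Qed.

(** * Continuity and compactness on boxes *)

Lemma continuous_dotv (T : topologicalType) (f g : T -> 'rV[R]_N) :
  continuous f -> continuous g -> continuous (fun t => dotv (f t) (g t)).
Proof.
move=> cf cg; apply: continuous_big; first exact: add_continuous.
move=> i _ t; apply: cvgM.
- exact: (cvg_comp _ _ (cf t) (@coord_continuous R 1 N ord0 i (f t))).
- exact: (cvg_comp _ _ (cg t) (@coord_continuous R 1 N ord0 i (g t))).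
Qed.

(** A cube rather than a Euclidean ball: it is a product of segments, hence compact. *)
Definition box (K : R) : set 'rV[R]_N := [set x | forall i, `[- K, K]%classic (x ord0 i)].

Lemma box_compact K : compact (box K).
Proof.
apply: (@rV_compact _ _ (fun=> `[- K, K]%classic)) => _.
exact: segment_compact.
Qed.

Lemma enorm_box K x : enorm x <= K -> box K x.
Proof.
move=> xK i /=; rewrite in_itv/= -ler_norml.
exact: le_trans (normr_coord_le x i) xK.
Qed.

Lemma continuous_sqdist :
  continuous (fun z : 'rV[R]_N * 'rV[R]_N => dotv (z.1 - z.2) (z.1 - z.2)).
Proof.
have cB : continuous (fun z : 'rV[R]_N * 'rV[R]_N => z.1 - z.2).
  by move=> z; apply: cvgB; [exact: cvg_fst|exact: cvg_snd].
exact: continuous_dotv.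
Qed.

Lemma continuous_on_fst (f : 'rV[R]_N -> R) : continuous f ->
  continuous (fun z : 'rV[R]_N * 'rV[R]_N => f z.1).
Proof. by move=> cf z; apply: continuous_comp; [exact: cvg_fst|exact: cf]. Qed.

Lemma continuous_on_snd (f : 'rV[R]_N -> R) : continuous f ->
  continuous (fun z : 'rV[R]_N * 'rV[R]_N => f z.2).
Proof. by move=> cf z; apply: continuous_comp; [exact: cvg_snd|exact: cf]. Qed.

(** The pairs on which [f] varies by at least [om] form a compact set avoiding the diagonal; the
    minimum [d] of the squared distance on it is therefore positive. If there is no such pair, any
    [d] works. *)
Lemma box_unif_continuous (f : 'rV[R]_N -> R) (K om : R) :
  continuous f -> 0 < om -> exists2 d : R, 0 < d & forall x y,
    box K x -> box K y -> dotv (x - y) (x - y) < d -> `|f x - f y| < om.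
Proof.
move=> cf om0.
pose g (z : 'rV[R]_N * 'rV[R]_N) := `|f z.1 - f z.2|.
have cg : continuous g.
  move=> z; apply: cvg_norm; apply: cvgB.
    exact: continuous_on_fst.
  exact: continuous_on_snd.
pose S := (box K `*` box K) `&` [set z | om <= g z].
have [[z0 S0]|nS] := pselect (S !=set0); last first.
  exists 1 => // x y xK yK _; rewrite ltNge; apply/negP => H; apply: nS.
  by exists (x, y).
have cS : compact S.
  apply: compact_closedI; first by apply: compact_setX; exact: box_compact.
  by have /continuous_closedP /(_ _ (@closed_ge R om)) := cg.
have [||c cSc minc] := @compact_EVT_min _ _
    (fun z : 'rV[R]_N * 'rV[R]_N => dotv (z.1 - z.2) (z.1 - z.2)) S _ cS.
- by exists z0.
- exact/continuous_subspaceT/continuous_sqdist.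
exists (dotv (c.1 - c.2) (c.1 - c.2)).
  rewrite lt_neqAle dotvv_ge0 andbT eq_sym; apply/eqP => c0.
  have /enorm_eq0/eqP : enorm (c.1 - c.2) = 0 by rewrite /enorm c0 sqrtr0.
  rewrite subr_eq0 => /eqP c12.
  move: cSc; rewrite inE => -[_]; rewrite /= /g c12 subrr normr0; lra.
move=> x y xK yK; rewrite !ltNge; apply: contra => H.
by apply: (minc (x, y)); rewrite inE.
Qed.

Lemma doubling_max (u w : 'rV[R]_N -> R) (K e : R) :
  continuous u -> continuous w -> 0 <= K ->
  exists x0 y0, [/\ box K x0, box K y0 & forall x y, box K x -> box K y ->
    u x - w y - e * dotv (x - y) (x - y)
    <= u x0 - w y0 - e * dotv (x0 - y0) (x0 - y0)].
Proof.
move=> cu cw K0.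
pose F (z : 'rV[R]_N * 'rV[R]_N) :=
  u z.1 - w z.2 - e * dotv (z.1 - z.2) (z.1 - z.2).
have cF : continuous F.
  move=> z; apply: cvgB; first apply: cvgB.
  - exact: continuous_on_fst.
  - exact: continuous_on_snd.
  - by apply: cvgM; [exact: cvg_cst|exact: continuous_sqdist].
have cQ : compact (box K `*` box K) by apply: compact_setX; exact: box_compact.
have b0 : box K 0.
  by apply: enorm_box; rewrite -(scale0r 0) enormZ normr0 mul0r.
have [||c cQc maxc] := @compact_EVT_max _ _ F _ _ cQ.
- by exists (0, 0).
- exact: continuous_subspaceT.
move: cQc; rewrite inE => -[Q1 Q2].
exists c.1, c.2; split => // x y xK yK.
by apply: (maxc (x, y)); rewrite inE.
Qed.

End euclidean.

(** * Quadratic test functions *)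

Section quadratic_test.
Context {R : realType} {N : nat}.
Implicit Types (x y z p v : 'rV[R]_N) (u : 'rV[R]_N -> R).

Definition quad_test u x0 p (k : R) : 'rV[R]_N -> R :=
  fun x => u x0 + dotv p (x - x0) + k * dotv (x - x0) (x - x0).

(* Increment of the glued function along a ray, without its linear part: the latter
   cancels in the symmetric integral, and vanishes when the gradient does. *)
Definition ray_incr u x0 (k r : R) v (eta : R) : R :=
  if eta < r then k * eta ^+ 2 else u (x0 + eta *: v) - u x0.

Lemma quad_test_center u x0 p k : quad_test u x0 p k x0 = u x0.
Proof. by rewrite /quad_test subrr dotvC !dotv0l mulr0 !addr0. Qed.

Lemma quad_test_C11 u x0 p k : C11_at (quad_test u x0 p k) x0 p.
Proof.
exists (`|k| + 1), 1; split; first by rewrite ltr_wpDl.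
split => // x _; rewrite quad_test_center /quad_test (addrC x0) addrK.
rewrite (_ : _ - _ = k * dotv x x); last by ring.
rewrite normrM sqr_enorm ler_pM//; first by rewrite lerDl.
by rewrite ger0_norm// dotvv_ge0.
Qed.

Lemma continuous_quad (T : topologicalType) (f : T -> 'rV[R]_N) p (a k : R) :
  continuous f -> continuous (fun t => a + dotv p (f t) + k * dotv (f t) (f t)).
Proof.
move=> cf t; apply: cvgD; first apply: cvgD.
- exact: cvg_cst.
- by apply: continuous_dotv => // y; exact: cvg_cst.
- by apply: cvgM; [exact: cvg_cst|exact: continuous_dotv].
Qed.

Lemma quad_test_continuous u x0 p k : continuous (quad_test u x0 p k).
Proof.
apply: continuous_quad => x; apply: (@continuousB _ _ _ id (cst x0) x) => //.
exact: cst_continuous.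
Qed.

Lemma continuous_ray x0 v : continuous (fun eta : R => x0 + eta *: v).
Proof.
move=> t; apply: cvgD; first exact: cvg_cst.
by apply: cvgZ; [by move=> A|exact: cvg_cst].
Qed.

Lemma measurable_ray_incr u x0 k r v : continuous u ->
  measurable_fun [set: R] (ray_incr u x0 k r v).
Proof.
move=> cu; apply: measurable_fun_ifT.
- exact: measurable_fun_ltr.
- by apply: measurable_funM => //; exact: measurable_funX.
- apply: measurable_funB => //; apply: continuous_measurable_fun => t.
  by apply: continuous_comp; [exact: continuous_ray|exact: cu].
Qed.

(** As [v] is a unit vector, the point at parameter [eta] lies in the ball exactly when
    [eta < r]. *)
Lemma glue_quad_ray u x0 p (k r : R) v (eta : R) : enorm v = 1 -> 0 < r -> 0 < eta ->
  Defs.glue u (quad_test u x0 p k) x0 r (x0 + eta *: v)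
  - Defs.glue u (quad_test u x0 p k) x0 r x0
  = ray_incr u x0 k r v eta + (if eta < r then eta * dotv p v else 0).
Proof.
move=> v1 r0 eta0.
have -> : Defs.glue u (quad_test u x0 p k) x0 r x0 = u x0.
  by rewrite /Defs.glue quad_test_center; case: asboolP.
rewrite /Defs.glue /eball/= (addrC x0) addrK enormZ v1 mulr1 ger0_norm ?ltW//.
rewrite /ray_incr (addrC x0); case: (asboolP (eta < r)) => [->|/negP/negbTE ->].
  rewrite /quad_test addrK !(dotvZl, dotvZr) -(sqr_enorm v) v1 expr1n; ring.
by rewrite addr0.
Qed.

(** The constant must not depend on the direction [v], so that the supremum and the infimum over the
    sphere are finite. *)
Lemma ray_incr_bound u x0 (k r alpha C : R) : 0 < r <= 1 -> 0 <= alpha -> 0 <= C ->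
  (forall x, `|u x| <= C * (1 + enorm x) `^ alpha) ->
  exists B : R, forall v eta, enorm v = 1 -> 0 < eta ->
    `|ray_incr u x0 k r v eta| <= B * growth_weight alpha eta.
Proof.
move=> /andP[r0 r1] al0 C0 Hu.
set L := 2 + enorm x0; have L0 : 2 <= L by rewrite lerDl enorm_ge0.
have La : 0 <= L `^ alpha by exact: powR_ge0.
have ri : 1 <= (r ^+ 2)^-1.
  by rewrite invf_ge1 ?exprn_gt0// expr_le1// ltW.
(* The first term serves for [eta < r]. Beyond, [1 + enorm x0 + eta] is at most [L] if [eta <= 1]
   and at most [L * eta] otherwise; the factor [(r ^+ 2)^-1] compensates the weight [eta ^+ 2] on
   [[r, 1]]. *)
exists (`|k| + 2 * C * L `^ alpha * (r ^+ 2)^-1) => v eta v1 eta0; have W0 := growth_weight_ge0 alpha eta.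
rewrite mulrDl /ray_incr; case: ifPn => etar.
  rewrite ler_wpDr//; first by rewrite !mulr_ge0// (le_trans _ ri).
  rewrite /growth_weight ifT; last by rewrite ltW// (lt_le_trans etar).
  by rewrite normrM ler_wpM2l// ger0_norm// sqr_ge0.
rewrite -leNgt in etar.
rewrite ler_wpDl//; first by rewrite mulr_ge0.
have xv : enorm (x0 + eta *: v) <= enorm x0 + eta.
  by rewrite (le_trans (enormD _ _))// enormZ v1 mulr1 ger0_norm// ltW.
have x00 := enorm_ge0 x0; have xe0 := enorm_ge0 (x0 + eta *: v).
have H1 : `|u (x0 + eta *: v) - u x0| <= 2 * C * (1 + enorm x0 + eta) `^ alpha.
  rewrite (le_trans (ler_normB _ _))// -mulrA mulr2n mulrDl mul1r lerD//.
    rewrite (le_trans (Hu _))// ler_wpM2l// ge0_ler_powR ?nnegrE//; lra.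
  by rewrite (le_trans (Hu _))// ler_wpM2l// ge0_ler_powR ?nnegrE//; lra.
rewrite (le_trans H1)// -!mulrA ler_wpM2l// ler_wpM2l// /growth_weight.
case: ifPn => e1.
  rewrite (@le_trans _ _ (L `^ alpha))//.
    by rewrite ge0_ler_powR ?nnegrE /L//; lra.
  rewrite ler_peMr// mulrC ler_pdivlMr ?exprn_gt0// mul1r.
  by rewrite ler_pXn2r ?nnegrE// ltW.
rewrite -ltNge in e1.
rewrite (@le_trans _ _ (L `^ alpha * eta `^ alpha))//; last first.
  by rewrite ler_wpM2l// ler_peMl// powR_ge0.
rewrite -powRM ?(ltW eta0)//; last by lra.
by rewrite ge0_ler_powR ?nnegrE /L//; nra.
Qed.

Section evaluation.
Variables (s alpha : R) (u : 'rV[R]_N -> R) (x0 : 'rV[R]_N) (k r : R).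
Hypotheses (s1 : s < 1) (as2 : alpha < 2 * s) (r0 : 0 < r).
Hypothesis au : forall v, enorm v = 1 -> admissible alpha (ray_incr u x0 k r v).
Local Notation I v := (kint s (ray_incr u x0 k r v)).

Lemma one_sided_quad v : enorm v = 1 ->
  one_sided_int s (Defs.glue u (quad_test u x0 0 k) x0 r) x0 v = (I v)%:E.
Proof.
move=> v1; rewrite -(kintE s1 as2 (au v1)) /one_sided_int.
apply: eq_integral => eta; rewrite inE/= in_itv/= andbT => eta0.
rewrite glue_quad_ray//; congr ((_ / _)%:E).
by rewrite dotv0l mulr0; case: ifP => _; rewrite addr0.
Qed.

Lemma frac_inf_lap_quad0 :
  frac_inf_lap s (Defs.glue u (quad_test u x0 0 k) x0 r) x0 0 =
  (ereal_sup [set (I y)%:E | y in @unit_sphere R N]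
   + ereal_inf [set (I (- z))%:E | z in @unit_sphere R N])%E.
Proof.
rewrite /frac_inf_lap eqxx/=; congr (_ + _)%E.
  congr ereal_sup; apply: eq_imagel => y /= y1; exact: one_sided_quad.
congr ereal_inf; apply: eq_imagel => y /= y1; apply: one_sided_quad.
by rewrite enormN.
Qed.

Lemma frac_inf_lap_quad p : p != 0 ->
  frac_inf_lap s (Defs.glue u (quad_test u x0 p k) x0 r) x0 p =
  (I ((enorm p)^-1 *: p) + I (- ((enorm p)^-1 *: p)))%:E.
Proof.
move=> p0; rewrite /frac_inf_lap p0.
have v1 := enorm_normalize p0; set v := _ *: p in v1 *.
have v1' : enorm (- v) = 1 by rewrite enormN.
rewrite -(kintD s1 as2 (au v1) (au v1')).
rewrite -(kintE s1 as2 (admissibleD (au v1) (au v1'))).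
apply: eq_integral => eta; rewrite inE/= in_itv/= andbT => eta0.
(* The symmetric increment is the sum of the increments along [v] and [- v], whose linear parts are
   opposite. *)
congr ((_ / _)%:E).
have := glue_quad_ray u x0 p k v1 r0 eta0.
have := glue_quad_ray u x0 p k v1' r0 eta0.
rewrite scalerN dotvNr; case: ifP => _; lra.
Qed.

End evaluation.
End quadratic_test.

(** * Common growth exponent, and strict comparison of sums of a supremum and an infimum *)

Lemma subcritical_growth_common (R : realType) (N : nat) (s : R) (u w : 'rV[R]_N -> R) :
  1 / 2 < s -> subcritical_growth s u -> subcritical_growth s w ->
  exists alpha C : R, [/\ 0 <= alpha, alpha < 2 * s, 0 < C,
    forall x, `|u x| <= C * (1 + enorm x) `^ alpha &
    forall x, `|w x| <= C * (1 + enorm x) `^ alpha].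
Proof.
move=> s2 [a1 [C1 [a1s [C10 H1]]]] [a2 [C2 [a2s [C20 H2]]]].
(* Exponents may be raised because [1 + enorm x >= 1]; including 1 makes [al] nonnegative, and
   [1 < 2 * s] keeps it subcritical. *)
pose al := Num.max 1 (Num.max a1 a2).
exists al, (C1 + C2); split.
- by rewrite le_max ler01.
- by rewrite !gt_max a1s a2s !andbT; lra.
- exact: addr_gt0.
- move=> x; rewrite (le_trans (H1 x))// ler_pM ?powR_ge0//; first exact: ltW.
    by rewrite lerDl ltW.
  by rewrite ler_powR ?lerDl ?enorm_ge0// !le_max lexx !orbT.
- move=> x; rewrite (le_trans (H2 x))// ler_pM ?powR_ge0//; first exact: ltW.
    by rewrite lerDr ltW.
  by rewrite ler_powR ?lerDl ?enorm_ge0// !le_max lexx !orbT.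
Qed.

(** The supremum and the infimum each increase by at least [d] from [f], [f'] to [g], [g']. The
    bounds by [B] make all four finite, so that the strict gap survives in the extended reals. *)
Lemma sup_inf_strict (R : realType) (T : Type) (S : set T) (f g f' g' : T -> R)
    (B d : R) : S !=set0 -> 0 < d ->
  (forall y, S y -> f y <= g y - d) -> (forall y, S y -> f' y <= g' y - d) ->
  (forall y, S y -> - B <= f y) -> (forall y, S y -> g y <= B) ->
  (forall y, S y -> - B <= f' y) -> (forall y, S y -> g' y <= B) ->
  (0 <= ereal_sup [set (f y)%:E | y in S] + ereal_inf [set (f' y)%:E | y in S])%E ->
  (ereal_sup [set (g y)%:E | y in S] + ereal_inf [set (g' y)%:E | y in S] <= 0)%E ->
  False.
Proof.
move=> [y0 Sy0] d0 fg fg' fB gB fB' gB'.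
set a := ereal_sup [set (f y)%:E | y in S]; set b := ereal_inf [set (f' y)%:E | y in S].
set c := ereal_sup [set (g y)%:E | y in S]; set e := ereal_inf [set (g' y)%:E | y in S].
have ac : (a <= c - d%:E)%E.
  apply: ge_ereal_sup => _ [y Sy <-].
  rewrite leeBrDr// (@le_trans _ _ (g y)%:E)//.
    by rewrite -EFinD lee_fin; have := fg _ Sy; lra.
  by apply: ereal_sup_ubound; exists y.
have be : (b + d%:E <= e)%E.
  apply: le_ereal_inf_tmp => _ [y Sy <-].
  rewrite -leeBrDr// (@le_trans _ _ (f' y)%:E)//.
    by apply: ereal_inf_lbound; exists y.
  by rewrite -EFinB lee_fin; have := fg' _ Sy; lra.
have aB : ((- B)%:E <= a)%E.
  rewrite (@le_trans _ _ (f y0)%:E) ?lee_fin ?fB//.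
  by apply: ereal_sup_ubound; exists y0.
have cB : (c <= B%:E)%E.
  by apply: ge_ereal_sup => _ [y Sy <-]; rewrite lee_fin gB.
have bB : ((- B)%:E <= b)%E.
  by apply: le_ereal_inf_tmp => _ [y Sy <-]; rewrite lee_fin fB'.
have eB : (e <= B%:E)%E.
  rewrite (@le_trans _ _ (g' y0)%:E) ?lee_fin ?gB'//.
  by apply: ereal_inf_lbound; exists y0.
move: a b c e ac be aB cB bB eB.
move=> [a| |] [b| |] [c| |] [e| |]//=; rewrite ?lee_fin//.
lra.
Qed.

(** * Comparison *)

Section comparison.
Context {R : realType} {N : nat}.
Implicit Types (x y p v : 'rV[R]_N) (u w : 'rV[R]_N -> R).

Lemma unit_sphere_nonempty : (1 <= N)%N -> @unit_sphere R N !=set0.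
Proof.
move=> N1; have x0 : (const_mx 1 : 'rV[R]_N) != 0.
  apply/eqP => /matrixP /(_ ord0 (Ordinal N1)); rewrite !mxE.
  by apply/eqP; exact: oner_neq0.
by eexists; exact: enorm_normalize x0.
Qed.

(** Both operators carry the same [p], hence fall in the same case of the definition: for [p != 0]
    the gap [d] is gained along [v] and along [- v], for [p = 0] in the supremum and in the
    infimum. *)
Lemma frac_inf_lap_strict (s alpha : R) u w x0 y0 p (k l r d Bu Bw : R) :
  (1 <= N)%N -> s < 1 -> alpha < 2 * s -> 0 < r -> 0 < d ->
  continuous u -> continuous w ->
  (forall v eta, enorm v = 1 -> 0 < eta ->
    `|ray_incr u x0 k r v eta| <= Bu * growth_weight alpha eta) ->
  (forall v eta, enorm v = 1 -> 0 < eta ->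
    `|ray_incr w y0 l r v eta| <= Bw * growth_weight alpha eta) ->
  (forall v, enorm v = 1 ->
    kint s (ray_incr u x0 k r v) <= kint s (ray_incr w y0 l r v) - d) ->
  (0 <= frac_inf_lap s (Defs.glue u (quad_test u x0 p k) x0 r) x0 p)%E ->
  (frac_inf_lap s (Defs.glue w (quad_test w y0 p l) y0 r) y0 p <= 0)%E ->
  False.
Proof.
move=> N1 s1 as2 r0 d0 cu cw Hu Hw uw.
have mu v : measurable_fun [set: R] (ray_incr u x0 k r v).
  exact: measurable_ray_incr.
have mw v : measurable_fun [set: R] (ray_incr w y0 l r v).
  exact: measurable_ray_incr.
have au v : enorm v = 1 -> admissible alpha (ray_incr u x0 k r v).
  by move=> v1; split => //; exists Bu => eta; exact: Hu.
have aw v : enorm v = 1 -> admissible alpha (ray_incr w y0 l r v).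
  by move=> v1; split => //; exists Bw => eta; exact: Hw.
have [->|p0] := eqVneq p 0; last first.
  rewrite !(frac_inf_lap_quad s1 as2)// !lee_fin.
  have v1 := enorm_normalize p0; set v := _ *: p in v1 *.
  have v1' : enorm (- v) = 1 by rewrite enormN.
  by have := uw v v1; have := uw _ v1'; lra.
rewrite !(frac_inf_lap_quad0 s1 as2)//.
pose W := kint s (growth_weight alpha).
have bu v : enorm v = 1 -> `|kint s (ray_incr u x0 k r v)| <= Bu * W.
  by move=> v1; apply: normr_kint_le => // eta; exact: Hu.
have bw v : enorm v = 1 -> `|kint s (ray_incr w y0 l r v)| <= Bw * W.
  by move=> v1; apply: normr_kint_le => // eta; exact: Hw.
pose B := `|Bu * W| + `|Bw * W|.
have uB v : enorm v = 1 -> - B <= kint s (ray_incr u x0 k r v).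
  move=> v1; have := bu _ v1; rewrite ler_norml => /andP[+ _].
  by have := ler_norm (Bu * W); have := normr_ge0 (Bw * W); rewrite /B; lra.
have wB v : enorm v = 1 -> kint s (ray_incr w y0 l r v) <= B.
  move=> v1; have := bw _ v1; rewrite ler_norml => /andP[_ +].
  by have := ler_norm (Bw * W); have := normr_ge0 (Bu * W); rewrite /B; lra.
apply: (sup_inf_strict (B := B) (unit_sphere_nonempty N1) d0).
- by move=> y; exact: uw.
- by move=> y y1; apply: uw; rewrite enormN.
- by move=> y; exact: uB.
- by move=> y; exact: wB.
- by move=> y y1; apply: uB; rewrite enormN.
- by move=> y y1; apply: wB; rewrite enormN.
Qed.

(* Along a ray, the increment of [u] from [x0] exceeds that of [w] from [y0] only
   near the origin, where the parabolas have replaced [u] and [w], and beyond [b]. *)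
Lemma kint_ray_incr_lt (s alpha k r a b c A : R) u w x0 y0 v (Bu Bw : R) :
  1 / 2 < s -> s < 1 -> 0 <= alpha -> alpha < 2 * s ->
  0 < r <= 1 -> 1 <= a -> a + 1 <= b -> 0 <= k -> 0 <= c -> 0 <= A ->
  continuous u -> continuous w ->
  (forall eta, 0 < eta ->
    `|ray_incr u x0 k r v eta| <= Bu * growth_weight alpha eta) ->
  (forall eta, 0 < eta ->
    `|ray_incr w y0 (- k) r v eta| <= Bw * growth_weight alpha eta) ->
  (forall eta, 0 < eta <= b ->
    u (x0 + eta *: v) - u x0 <= w (y0 + eta *: v) - w y0) ->
  (forall eta, a <= eta <= a + 1 ->
    u (x0 + eta *: v) - u x0 <= w (y0 + eta *: v) - w y0 - c) ->
  (forall eta, b <= eta ->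
    u (x0 + eta *: v) - u x0 <= w (y0 + eta *: v) - w y0 + A * eta `^ alpha) ->
  kint s (ray_incr u x0 k r v) <= kint s (ray_incr w y0 (- k) r v)
    + (2 * k * (r `^ (2 - 2 * s) / (2 - 2 * s)) - c / (a + 1) `^ (1 + 2 * s)
       + A * (b `^ (- (2 * s - alpha)) / (2 * s - alpha))).
Proof.
move=> s2 s1 al0 as2 /andP[r0 r1] a1 ab k0 c0 A0 cu cw Hu Hw near mid far.
have au : admissible alpha (ray_incr u x0 k r v).
  by split; [exact: measurable_ray_incr|exists Bu].
have aw : admissible alpha (ray_incr w y0 (- k) r v).
  by split; [exact: measurable_ray_incr|exists Bw].
have b1 : 1 <= b by lra.
have b0 : 0 < b by lra.
have a1_ := admissible_near0 alpha (2 * k) r1.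
have a2_ := admissible_gap c al0 a1.
have a3_ := admissible_tail alpha A b1.
have k20 : 0 <= 2 * k by lra.
have K1 := kint_near0 s1 k20 r0.
have K2 := kint_gap s2 s1 al0 as2 c0 a1.
have K3 := kint_tail A as2 b0.
have a23 := admissibleD a2_ a3_.
have a123 := admissibleD a1_ a23.
have := le_kint s1 as2 au (admissibleD aw a123).
rewrite (kintD s1 as2 aw a123) (kintD s1 as2 a1_ a23) (kintD s1 as2 a2_ a3_) K3.
move=> H; rewrite (le_trans (H _))//; last first.
  by rewrite lerD2l -addrA lerD// lerD2r.
(* For [eta < r <= 1] only the first profile is active, and it equals the difference
   [2 * k * eta ^+ 2] of the two parabolas. *)
move=> eta eta0; rewrite /ray_incr; case: ifPn => etar.
  have -> : (a <= eta) = false by apply/negbTE; rewrite -ltNge; lra.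
  have -> : (b <= eta) = false by apply/negbTE; rewrite -ltNge; lra.
  rewrite /=; lra.
rewrite add0r; have P0 : 0 <= A * eta `^ alpha by rewrite mulr_ge0// powR_ge0.
(* The gap and the tail meet when [eta = b = a + 1]; the gap estimate suffices there, the tail being
   nonnegative. *)
case: ifPn => [am|_].
  by have := mid _ am; case: ifPn => _; lra.
case: ifPn => be; first by rewrite add0r; exact: far.
by rewrite addr0 addr0 near// eta0 ltW// ltNge.
Qed.

(** Expanding [e * dotv (x - y0) (x - y0)] about [x0] gives the paraboloid of gradient
    [(2 * e) *: (x0 - y0)] and coefficient [e]; raising the coefficient to [e + 1] makes the contact
    strict. *)
Lemma quad_test_above u x0 y0 x (e : R) : x != x0 ->
  u x - e * dotv (x - y0) (x - y0) <= u x0 - e * dotv (x0 - y0) (x0 - y0) ->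
  u x < quad_test u x0 ((2 * e) *: (x0 - y0)) (e + 1) x.
Proof.
move=> xx0; rewrite /quad_test dotvZl.
have -> : x - y0 = (x - x0) + (x0 - y0) by rewrite addrA subrK.
have h0 : 0 < dotv (x - x0) (x - x0).
  rewrite lt_neqAle dotvv_ge0 andbT eq_sym -sqr_enorm sqrf_eq0.
  by apply: contra xx0 => /eqP/enorm_eq0/eqP; rewrite subr_eq0.
rewrite !(dotvDl (x - x0), dotvDr _ (x - x0)) (dotvC (x - x0) (x0 - y0)).
move: h0; set h := dotv (x - x0) _; set q := dotv (x0 - y0) (x - x0).
set z := dotv (x0 - y0) (x0 - y0); lra.
Qed.

(** Turns contact from below with [w] into contact from above with [- w], so that [quad_test_above]
    serves for both functions. *)
Lemma quad_test_opp w y0 p (k : R) y :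
  quad_test (fun z => - w z) y0 (- p) k y = - quad_test w y0 p (- k) y.
Proof. by rewrite /quad_test dotvNl; lra. Qed.

End comparison.

Theorem theorem3p2 (R : realType) (N : nat) (s : R)
  (Omega : set 'rV[R]_N) (u w : 'rV[R]_N -> R) :
  (1 <= N)%N ->
  1 / 2 < s -> s < 1 ->
  open Omega ->
  (exists M : R, forall x, Omega x -> enorm x <= M) ->
  continuous u -> continuous w ->
  (forall x0, Omega x0 -> visc_sub s u x0) ->
  (forall x0, Omega x0 -> visc_super s w x0) ->
  subcritical_growth s u -> subcritical_growth s w ->
  (forall x, ~ Omega x -> u x <= w x) ->
  forall x, Omega x -> u x <= w x.
Proof.
move=> N1 s2 s1 _ [M HM] cu cw subu superw gu gw out xh Oxh.
rewrite leNgt; apply/negP => wu.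
have [alpha [C [al0 as2 C0 Hu Hw]]] := subcritical_growth_common s2 gu gw.
set m := u xh - w xh; have m0 : 0 < m by rewrite subr_gt0.
pose D := Num.max M 0; have D0 : 0 <= D by rewrite le_max lexx orbT.
have OD x : Omega x -> enorm x <= D by move=> /HM xM; rewrite le_max xM.
(* Two points of [Omega] are at distance at most [2 * D], so a ray issued from [Omega] is outside
   [Omega] at every parameter [eta >= a]. *)
pose a := 2 * D + 1; have a1 : 1 <= a by rewrite /a; lra.
have P0 : 0 < (a + 1) `^ (1 + 2 * s) by rewrite powR_gt0//; lra.
pose d := m / 2 / (a + 1) `^ (1 + 2 * s).
have d0 : 0 < d by rewrite !divr_gt0.
pose A := 2 * C * 2 `^ alpha.
have A0 : 0 < A by rewrite !mulr_gt0// powR_gt0.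
have g1 : 0 < 2 * s - alpha by lra.
(* The tail is made at most [d / 4] before [e] is chosen, because the box, and hence the maximum
   point, depends on [b]. *)
have [|b ab Hb] := @exists_powRN_small R (2 * s - alpha)
    (d / 4 * (2 * s - alpha) / A) (a + 1) g1.
  by rewrite !(divr_gt0, mulr_gt0).
have {}Hb : A * (b `^ (- (2 * s - alpha)) / (2 * s - alpha)) <= d / 4.
  by rewrite mulrA ler_pdivrMr// mulrC -ler_pdivlMr.
(* Rays from [Omega] stay in the box up to length [b]. *)
pose K := D + b; have K0 : 0 <= K by rewrite /K; lra.
have m20 : 0 < m / 2 by rewrite divr_gt0.
have [du du0 Hdu] := box_unif_continuous K cu m20.
have [dw dw0 Hdw] := box_unif_continuous K cw m20.
(* Without penalization ([e = 0]) the maximum bounds [u x - w y] over all pairs of the box. *)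
have [x1 [y1 [_ _ HB]]] := doubling_max 0 cu cw K0.
pose B := u x1 - w y1.
have {}HB x y : box K x -> box K y -> u x - w y <= B.
  by move=> xK yK; have := HB x y xK yK; rewrite !mul0r !subr0.
have bxh : box K xh.
  by apply: enorm_box; rewrite (le_trans (OD _ Oxh))// /K lerDl; lra.
have mB : m <= B by exact: HB.
pose dd := Num.min du dw; have dd0 : 0 < dd by rewrite lt_min du0.
(* An explicit choice in place of a limit: at the maximum the penalty is at most
   [B - m < B = e * dd], so the squared distance is below [dd]. *)
pose e := B / dd; have e0 : 0 < e by rewrite divr_gt0//; lra.
have [x0 [y0 [bx0 by0 Hmax]]] := doubling_max e cu cw K0.
have Hm : m <= u x0 - w y0 - e * dotv (x0 - y0) (x0 - y0).
  by have := Hmax xh xh bxh bxh; rewrite subrr dotv0l mulr0 subr0.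
have sq0 := dotvv_ge0 (x0 - y0).
have muw : m <= u x0 - w y0.
  by rewrite (le_trans Hm)// gerBl mulr_ge0// ltW.
have sqd : dotv (x0 - y0) (x0 - y0) < dd.
  rewrite -(ltr_pM2l e0) (_ : e * dd = B); last by rewrite /e divfK// gt_eqF.
  by have := HB _ _ bx0 by0; lra.
have [sqdu sqdw] : dotv (x0 - y0) (x0 - y0) < du /\ dotv (x0 - y0) (x0 - y0) < dw.
  by move: sqd; rewrite lt_min => /andP.
(* Otherwise [m <= u x0 - w y0 <= w x0 - w y0 < m / 2]; the same argument with [u] places [y0] in
   [Omega]. *)
have Ox0 : Omega x0.
  apply: contrapT => /out uwx0; have := Hdw _ _ bx0 by0 sqdw.
  rewrite ltr_norml => /andP[]; lra.
have Oy0 : Omega y0.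
  apply: contrapT => /out uwy0; have := Hdu _ _ bx0 by0 sqdu.
  rewrite ltr_norml => /andP[]; lra.
have x0D := OD _ Ox0; have y0D := OD _ Oy0.
pose k := e + 1; have k0 : 0 < k by rewrite /k; lra.
have g2 : 0 < 2 - 2 * s by lra.
(* The radius comes last since it depends on [k], hence on [e]. The budget is
   [d / 4 - d + d / 4 = - (d / 2)]. *)
have [|r /andP[r0 r1] Hr] := @exists_powR_small R (2 - 2 * s)
    (d / 4 * (2 - 2 * s) / (2 * k)) g2.
  by rewrite !(divr_gt0, mulr_gt0).
have {}Hr : 2 * k * (r `^ (2 - 2 * s) / (2 - 2 * s)) <= d / 4.
  by rewrite mulrA ler_pdivrMr// mulrC -ler_pdivlMr// mulr_gt0.
have r01 : 0 < r <= 1 by rewrite r0 ltW.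
have [Bu HBu] := ray_incr_bound x0 k r01 al0 (ltW C0) Hu.
have [Bw HBw] := ray_incr_bound y0 (- k) r01 al0 (ltW C0) Hw.
have ray_le (x v : 'rV[R]_N) (eta : R) : enorm x <= D -> enorm v = 1 -> 0 < eta ->
    enorm (x + eta *: v) <= D + eta.
  move=> xD v1 eta0; rewrite (le_trans (enormD _ _))// enormZ v1 mulr1.
  by rewrite ger0_norm ?lerD2r// ltW.
have ray_box (x v : 'rV[R]_N) (eta : R) : enorm x <= D -> enorm v = 1 -> 0 < eta <= b ->
    box K (x + eta *: v).
  move=> xD v1 /andP[eta0 eb]; apply: enorm_box.
  by rewrite (le_trans (ray_le _ _ _ xD v1 eta0))// lerD2l.
have rayB (v : 'rV[R]_N) (eta : R) : x0 + eta *: v - (y0 + eta *: v) = x0 - y0.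
  by rewrite opprD addrACA subrr addr0.
have ball_box (x z : 'rV[R]_N) : enorm x <= D -> eball x r z -> box K z.
  rewrite /eball/= => xD zx; apply: enorm_box.
  by have := enormD (z - x) x; rewrite subrK /K; lra.
apply: (@frac_inf_lap_strict _ _ s alpha u w x0 y0 ((2 * e) *: (x0 - y0))
  k (- k) r (d / 2) Bu Bw) => //.
- by rewrite divr_gt0.
- move=> v v1.
  have H := @kint_ray_incr_lt _ _ s alpha k r a b (m / 2) A u w x0 y0 v Bu Bw
    s2 s1 al0 as2 r01 a1 ab (ltW k0) (ltW m20) (ltW A0) cu cw.
  rewrite (le_trans (H _ _ _ _ _))//.
  + by move=> eta; exact: HBu.
  + by move=> eta; exact: HBw.
  (* Translating both points by the same vector leaves the penalty unchanged. *)
  + move=> eta etab; have := Hmax _ _ (ray_box _ _ _ x0D v1 etab)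
      (ray_box _ _ _ y0D v1 etab); rewrite rayB; lra.
  + move=> eta /andP[ae ea]; have etab : 0 < eta <= b by lra.
    have nO : ~ Omega (x0 + eta *: v).
      move=> /OD Hx; have := enormD (x0 + eta *: v) (- x0).
      rewrite addrAC subrr add0r enormN enormZ v1 mulr1 ger0_norm; last by lra.
      by rewrite /a in ae; lra.
    have bx := ray_box _ _ _ x0D v1 etab; have by_ := ray_box _ _ _ y0D v1 etab.
    (* Outside [Omega], [u <= w], and [w] varies by less than [m / 2] between the two rays; the
       increments thus differ by [m / 2], as [u x0 - w y0 >= m]. *)
    have := Hdw _ _ bx by_; rewrite rayB => /(_ sqdw).
    rewrite ltr_norml => /andP[_ +]; have := out _ nO; lra.
  (* Only the far values need the growth bound, with [1 + D + eta <= 2 * eta]; the base points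
     contribute with a favourable sign because [u x0 - w y0 >= m > 0]. *)
  + move=> eta be; have eta0 : 0 < eta by lra.
    have De : 1 + (D + eta) <= 2 * eta by rewrite /a in ab; lra.
    have P (x : 'rV[R]_N) (f : 'rV[R]_N -> R) : enorm x <= D ->
        (forall z, `|f z| <= C * (1 + enorm z) `^ alpha) ->
        `|f (x + eta *: v)| <= C * (2 `^ alpha * eta `^ alpha).
      move=> xD Hf; rewrite (le_trans (Hf _))// ler_wpM2l ?(ltW C0)//.
      rewrite -powRM ?(ltW eta0)// ge0_ler_powR ?nnegrE//.
      * by rewrite addr_ge0// enorm_ge0.
      * by rewrite mulr_ge0// ltW.
      * by have := ray_le _ _ _ xD v1 eta0; lra.
    have := P _ _ x0D Hu; rewrite ler_norml => /andP[_ +].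
    have := P _ _ y0D Hw; rewrite ler_norml => /andP[+ _].
    rewrite /A -!mulrA; lra.
  + have -> : m / 2 / (a + 1) `^ (1 + 2 * s) = d by [].
    lra.
- apply: subu => //.
  + exact: quad_test_C11.
  + exact/continuous_subspaceT/quad_test_continuous.
  + exact: quad_test_center.
  + move=> x xr xx0; apply: quad_test_above => //.
    by have := Hmax _ _ (ball_box _ _ x0D xr) by0; lra.
- apply: superw => //.
  + exact: quad_test_C11.
  + exact/continuous_subspaceT/quad_test_continuous.
  + exact: quad_test_center.
  (* With [x0] fixed, [y0] maximizes the penalized [- w], whose paraboloid has gradient
     [(2 * e) *: (y0 - x0)]. *)
  + move=> y yr yy0; rewrite -ltrN2 -quad_test_opp -scalerN opprB.
    apply: (quad_test_above (u := fun z => - w z)) => //.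
    have := Hmax _ _ bx0 (ball_box _ _ y0D yr).
    rewrite -(opprB y x0) -(opprB y0 x0) !(dotvNl, dotvNr) !opprK; lra.
Qed.
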